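(* Let $(X_i,f_i)_{i\in\mathbb{N}}$ be an inverse sequence of locally compact Hausdorff spaces and continuous maps $f_i\colon X_{i+1}\to X_i$, and let $\mathcal{U}=(U_i)_{i\in\mathbb{N}}$ be a regulating sequence for $(X_i,f_i)_{i\in\mathbb{N}}$. Then: (a) The $\mathcal{U}$-regulated limit $\varprojlim^{\mathcal{U}}(X_i,f_i)$ is a locally compact Hausdorff space. (b) The universal projections $\pi^{\mathcal{U}}_k\colon\varprojlim^{\mathcal{U}}(X_i,f_i)\to X^{\mathcal{U}}_k$ are proper, and they are perfect if $\mathcal{U}$ is perfect. (c) The inclusions $\iota_{X_k}\colon X_k\hookrightarrow X^{\mathcal{U}}_k$, $k\in\mathbb{N}$, induce a continuous inclusion $\varprojlim(X_i,f_i)\hookrightarrow\varprojlim^{\mathcal{U}}(X_i,f_i)$. (d) If each $X_i$ is second countable, then $\varprojlim^{\mathcal{U}}(X_i,f_i)$ is metrisable. (e) If $\mathcal{V}=(V_i)_{i\in\mathbb{N}}$ is another regulating sequence for $(X_i,f_i)_{i\in\mathbb{N}}$ such that $U_i\subseteq V_i$ for all $i\in\mathbb{N}$, then $\varprojlim^{\mathcal{V}}(X_i,f_i)$ can be identified with the closed subset $\varprojlim(X_i,f_i)\sqcup\bigsqcup_{i=0}^\infty(X_i\setminus V_i)$ of $\varprojlim^{\mathcal{U}}(X_i,f_i)$. In particular, $\varprojlim^{\mathcal{U}}(X_i,f_i)$ can be identified with the closed subset $\varprojlim(X_i,f_i)\sqcup\bigsqcup_{i=0}^\infty(X_i\setminus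 U_i)$ of the unified limit $\varprojlim^{\uplus}(X_i,f_i)$.
   Context: $\mathbb{N}$ contains $0$. A map is proper if preimages of compact sets are compact; a continuous map between locally compact Hausdorff spaces is perfect if it is proper and surjective. Unified space. For a continuous map $f\colon X\to Y$ of locally compact Hausdorff spaces, $X\uplus_f Y$ is the set $X\sqcup Y$, with the map $f_\uplus\colon X\uplus_f Y\to Y$, $f_\uplus|_X=f$, $f_\uplus|_Y=\mathrm{id}_Y$, and the topology with base consisting of all open subsets of $X$ and all sets $f_\uplus^{-1}(V)\cap((X\sqcup Y)\setminus K)$ with $V\subseteq Y$ open and $K\subseteq X$ compact. An open set $U\subseteq Y$ is $f$-proper if $f|_{f^{-1}(U)}\colon f^{-1}(U)\to U$ is proper, and $f$-perfect if this restriction is perfect. For $f$-proper $U$, $X\uplus_f^U Y:=X\sqcup(Y\setminus U)$ with the subspace topology from $X\uplus_f Y$, and $f_U:=f_\uplus|_{X\uplus_f^U Y}\colon X\uplus_f^UY\to Y$. The inclusion $X\hookrightarrow X\uplus_f^U Y$ is an open embedding. A regulating sequence for $(X_i,f_i)_{i\in\mathbb{N}}$ is a family $\mathcal{U}=(U_i)_{i\in\mathbb{N}}$ of open sets $U_i\subseteq X_i$ with each $U_i$ being $f_i$-proper; it is perfect if each $U_i$ is $f_i$-perfect. Put $X_0^{\mathcal{U}}:=X_0$ and, for $i\ge1$, $X_i^{\mathcal{U}}:=X_i\uplus^{U_{i-1}}_{\iota_{X_{i-1}}\circ f_{i-1}}X_{i-1}^{\mathcal{U}}$, where $\iota_{X_{i-1}}\colon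 X_{i-1}\hookrightarrow X_{i-1}^{\mathcal{U}}$ is the open inclusion and $U_{i-1}$ is regarded as a subset of $X_{i-1}^{\mathcal U}$; so as a set $X_i^{\mathcal{U}}=X_i\sqcup\bigsqcup_{k=0}^{i-1}(X_k\setminus U_k)$. Let $f_i^{\mathcal{U}}:=(\iota_{X_i}\circ f_i)_{U_i}\colon X_{i+1}^{\mathcal{U}}\to X_i^{\mathcal{U}}$, i.e. $f_i^{\mathcal{U}}(x)=f_i(x)$ for $x\in X_{i+1}$ and $f_i^{\mathcal{U}}(x)=x$ for $x\in X_i^{\mathcal{U}}\setminus U_i$. The $\mathcal{U}$-regulated limit is the topological inverse limit $\varprojlim^{\mathcal{U}}(X_i,f_i):=\varprojlim(X_i^{\mathcal{U}},f_i^{\mathcal{U}})$. The unified limit $\varprojlim^{\uplus}(X_i,f_i)$ is the regulated limit for $\mathcal{U}=(\varnothing)_{i\in\mathbb{N}}$. Identification of sets: a point of $\varprojlim(X_i,f_i)$ is viewed in $\varprojlim^{\mathcal{U}}(X_i,f_i)$ via the inclusions $X_k\subseteq X_k^{\mathcal U}$, and a point $x\in X_i\setminus U_i$ is viewed as the sequence whose $k$-th coordinate is $f_k\circ\cdots\circ f_{i-1}(x)$ for $k<i$ and $x$ for $k\ge i$; in this way $\varprojlim^{\mathcal{U}}(X_i,f_i)=\varprojlim(X_i,f_i)\sqcup\bigsqcup_{i=0}^\infty(X_i\setminus U_i)$ as sets. *)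

(* Defs.v *)
From HB Require Import structures.
From mathcomp Require Import all_boot all_order all_algebra finmap.
From mathcomp Require Import all_classical all_reals all_analysis.

Set Implicit Arguments.
Unset Strict Implicit.
Unset Printing Implicit Defensive.

Import Order.TTheory GRing.Theory Num.Theory.

Local Open Scope classical_set_scope.

(* Spaces are [topologicalType]s, which may be empty.  A subset coerces to the
   subtype [set_type], which carries the subspace topology. *)

Definition proper_map (S T : topologicalType) (f : S -> T) : Prop :=
  forall K : set T, compact K -> compact (f @^-1` K).

Definition perfect_map (S T : topologicalType) (f : S -> T) : Prop :=
  [/\ continuous f, proper_map f & range f = [set: T]].

Definition homeomorphism (S T : topologicalType) (f : S -> T) : Prop :=
  exists g : T -> S, [/\ cancel f g, cancel g f, continuous f & continuous g].

Definition metrisable (R : realType) (T : topologicalType) : Prop :=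
  exists d : T -> T -> R,
    [/\ (forall x y, (0 <= d x y)%R) /\ (forall x y, d x y = 0%R <-> x = y),
        (forall x y, d x y = d y x),
        (forall x y z, (d x z <= d x y + d y z)%R) &
        (forall A : set T, open A <->
           forall x, A x ->
             exists2 e : R, (0 < e)%R & [set y | (d x y < e)%R] `<=` A)].

(* The restriction f^-1(U) -> U of f. *)
Definition restr_preimage (S T : Type) (f : S -> T) (U : set T)
    (x : f @^-1` U) : U :=
  SigSub (mem_set (set_valP x : U (f (set_val x)))).

Definition f_proper (S T : topologicalType) (f : S -> T) (U : set T) : Prop :=
  open U /\ proper_map (@restr_preimage S T f U).

Definition f_perfect (S T : topologicalType) (f : S -> T) (U : set T) : Prop :=
  open U /\ perfect_map (@restr_preimage S T f U).

Definition unified (X Y : Type) (f : X -> Y) : Type := (X + Y)%type.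

Section UnifiedSpace.
Context {X Y : topologicalType} (f : X -> Y).

Definition unl (x : X) : unified f := inl x.
Definition unr (y : Y) : unified f := inr y.

Definition unified_map (z : unified f) : Y :=
  match z with inl x => f x | inr y => y end.

Definition unified_base : set (set (unified f)) :=
  [set unl @` O | O in [set O : set X | open O]] `|`
  [set A | exists V : set Y, exists K : set X,
     [/\ open V, compact K & A = unified_map @^-1` V `&` ~` (unl @` K)]].

HB.instance Definition _ := Choice.on (unified f).

(* The topology generated by [unified_base]; no hypothesis on X or f is needed
   to define it, and by [unified_basis] the generating family is a base as soon
   as X is Hausdorff and f is continuous. *)
HB.instance Definition _ :=
  isSubBaseTopological.Build (unified f) unified_base id.

(* The underlying set of the space X \uplus_f^U Y. *)
Definition runified (U : set Y) : set (unified f) :=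
  range unl `|` unr @` (~` U).

Definition runified_incl (U : set Y) (x : X) : runified U :=
  SigSub (mem_set (or_introl (imageT unl x) : runified U (unl x))).

Definition runified_map (U : set Y) (z : runified U) : Y :=
  unified_map (set_val z).

Lemma unified_basis : hausdorff_space X -> continuous f -> basis unified_base.
Proof.
move=> hX cf.
have baseI A B : unified_base A -> unified_base B -> unified_base (A `&` B).
  have oL G V K : open G -> open V -> compact K ->
      unified_base (unl @` G `&` (unified_map @^-1` V `&` ~` (unl @` K))).
    move=> oG oV cK; left; exists (G `&` (f @^-1` V `&` ~` K)).
      apply: openI => //; apply: openI; first by apply: open_comp.
      by apply: closed_openC; exact: compact_closed.
    rewrite eqEsubset; split=> [_ [x [Gx [Vx nKx]] <-]|].
      split; first by exists x.
      by split=> // -[y Ky [yx]]; apply: nKx; rewrite -yx.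
    move=> _ [[x Gx <-] [Vx nKx]]; exists x => //; split => //; split => //.
    by move=> Kx; apply: nKx; exists x.
  move=> [[G oG <-]|[V [K [oV cK ->]]]] [[H oH <-]|[W [L [oW cL ->]]]].
  - left; exists (G `&` H); first exact: openI.
    rewrite eqEsubset; split=> [_ [x [Gx Hx] <-]|]; first by split; exists x.
    by move=> _ [[x Gx <-] [y Hy [yx]]]; exists x => //; split => //; rewrite -yx.
  - exact: oL.
  - by rewrite setIC; exact: oL.
  - right; exists (V `&` W), (K `|` L); split.
    + exact: openI.
    + exact: compactU.
    + by rewrite image_setU setCU preimage_setI setIACA.
have baseT : unified_base setT.
  right; exists setT, set0; split; [exact: openT|exact: compact0|].
  by rewrite image_set0 setC0 setIT preimage_setT.
have baseF (D : {fset set (unified f)}) :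
    {subset D <= unified_base} -> unified_base (\bigcap_(i in [set` D]) i).
  move=> sD; rewrite bigcap_fset big_seq; apply: big_ind => // A /sD.
  by rewrite inE.
split.
  move=> A bA; exists [set A]; last by rewrite bigcup_set1.
  move=> _ ->; exists [fset A]%fset.
    by move=> B /fset1P ->; rewrite inE.
  by rewrite set_fset1 bigcap_set1.
move=> z A; rewrite /= nbhsE => -[B [ [D sD <-] [C DC Cz]] BA].
have [E sE EC] := sD _ DC.
exists C; last by move=> y Cy; apply: BA; exists C.
by split=> //; rewrite -EC; exact: baseF.
Qed.

End UnifiedSpace.
Arguments runified {X Y} f U _.
Arguments runified_map {X Y} f U _.

Definition regulating (X : nat -> topologicalType)
    (f : forall i, X i.+1 -> X i) (U : forall i, set (X i)) : Prop :=
  forall i, f_proper (f i) (U i).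

Definition perfect_regulating (X : nat -> topologicalType)
    (f : forall i, X i.+1 -> X i) (U : forall i, set (X i)) : Prop :=
  forall i, f_perfect (f i) (U i).

Definition invlim (X : nat -> topologicalType)
    (f : forall i, X i.+1 -> X i) : set (prod_topology X) :=
  [set x | forall i, f i (x i.+1) = x i].
Arguments invlim {X} f _.

Definition invlim_proj (X : nat -> topologicalType)
    (f : forall i, X i.+1 -> X i) (k : nat) (x : invlim f) : X k :=
  set_val x k.

(* The space X_i^U together with the inclusion of X_i into it. *)
Fixpoint reg_stage (X : nat -> topologicalType) (f : forall i, X i.+1 -> X i)
    (U : forall i, set (X i)) (i : nat) : {T : topologicalType & X i -> T} :=
  match i with
  | 0 => existT (fun T : topologicalType => X 0 -> T) (X 0) id
  | i.+1 =>
    let iota := projT2 (reg_stage f U i) in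
    existT (fun T : topologicalType => X i.+1 -> T)
      (set_type (runified (iota \o f i) (iota @` U i)))
      (runified_incl (iota \o f i) (iota @` U i))
  end.

Definition reg_space (X : nat -> topologicalType)
    (f : forall i, X i.+1 -> X i) (U : forall i, set (X i))
    (i : nat) : topologicalType :=
  projT1 (reg_stage f U i).

Definition reg_incl (X : nat -> topologicalType)
    (f : forall i, X i.+1 -> X i) (U : forall i, set (X i))
    (i : nat) : X i -> reg_space f U i :=
  projT2 (reg_stage f U i).
Arguments reg_incl {X} f U i _.

Definition reg_map (X : nat -> topologicalType)
    (f : forall i, X i.+1 -> X i) (U : forall i, set (X i))
    (i : nat) : reg_space f U i.+1 -> reg_space f U i :=
  runified_map (reg_incl f U i \o f i) (reg_incl f U i @` U i).
Arguments reg_map {X} f U i _.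

Definition reglim (X : nat -> topologicalType)
    (f : forall i, X i.+1 -> X i) (U : forall i, set (X i)) :
    set (prod_topology (reg_space f U)) :=
  invlim (reg_map f U).
Arguments reglim {X} f U _.

Definition reglim_proj (X : nat -> topologicalType)
    (f : forall i, X i.+1 -> X i) (U : forall i, set (X i)) (k : nat) :
    reglim f U -> reg_space f U k :=
  @invlim_proj _ (reg_map f U) k.
Arguments reglim_proj {X} f U k _.

Lemma lim_incl_subproof (X : nat -> topologicalType)
    (f : forall i, X i.+1 -> X i) (U : forall i, set (X i)) (x : invlim f) :
  reglim f U (fun k => reg_incl f U k (invlim_proj k x)).
Proof. by move=> k; exact: (congr1 (reg_incl f U k) (set_valP x k)). Qed.

(* The map of inverse limits induced by the inclusions of X_k into X_k^U. *)
Definition lim_incl (X : nat -> topologicalType)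
    (f : forall i, X i.+1 -> X i) (U : forall i, set (X i)) (x : invlim f) :
    reglim f U :=
  SigSub (mem_set (lim_incl_subproof U x)).
Arguments lim_incl {X} f U _.

(* The composite f_k \o ... \o f_(n + k - 1). *)
Fixpoint bond (X : nat -> topologicalType) (f : forall i, X i.+1 -> X i)
    (n k : nat) : X (n + k) -> X k :=
  match n with
  | 0 => id
  | n.+1 => fun x => bond f (f (n + k) x)
  end.

(* w is the point y of X_k^U \ U_k regarded as a point of X_(k+1)^U. *)
Definition reg_copy (X : nat -> topologicalType)
    (f : forall i, X i.+1 -> X i) (U : forall i, set (X i)) (k : nat)
    (y : reg_space f U k) (w : reg_space f U k.+1) : Prop :=
  set_val (w : runified (reg_incl f U k \o f k) (reg_incl f U k @` U k)) =
  unr (reg_incl f U k \o f k) y.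

(* z is the sequence as which the point x of X_i \ U_i is viewed in the
   regulated limit: its k-th coordinate is f_k (... (f_(i-1) x)) for k <= i,
   and x again for k >= i. *)
Definition stage_point (X : nat -> topologicalType)
    (f : forall i, X i.+1 -> X i) (U : forall i, set (X i)) (i : nat)
    (x : X i) (z : reglim f U) : Prop :=
  (forall (n k : nat) (e : i = (n + k)%N),
     reglim_proj f U k z = reg_incl f U k (bond f (ecast j (X j) e x))) /\
  (forall k : nat, (i <= k)%N ->
     reg_copy (reglim_proj f U k z) (reglim_proj f U k.+1 z)).

(* The subset lim (X_i, f_i) \sqcup \bigsqcup_i (X_i \ V_i) of the U-regulated
   limit, for U_i contained in V_i. *)
Definition sub_reglim (X : nat -> topologicalType)
    (f : forall i, X i.+1 -> X i) (U V : forall i, set (X i)) :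
    set (reglim f U) :=
  range (lim_incl f U) `|`
  \bigcup_i [set z | exists2 x : X i, ~ V i x & stage_point x z].
Arguments sub_reglim {X} f U V _.

(* The V-regulated limit is identified with the closed subset [sub_reglim f U V]
   of the U-regulated limit, by a homeomorphism which is the identity on the
   points of lim (X_i, f_i) and of X_i \ V_i. *)
Definition identified_with_closed_subset (X : nat -> topologicalType)
    (f : forall i, X i.+1 -> X i) (U V : forall i, set (X i)) : Prop :=
  closed (sub_reglim f U V) /\
  exists h : reglim f V -> sub_reglim f U V,
    [/\ homeomorphism h,
        forall x : invlim f, set_val (h (lim_incl f V x)) = lim_incl f U x &
        forall (i : nat) (x : X i) (z : reglim f V),
          ~ V i x -> stage_point x z -> stage_point x (set_val (h z))].

(* Main.v *)
Require Import Defs.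
From HB Require Import structures.
From mathcomp Require Import all_boot all_order all_algebra.
From mathcomp Require Import all_classical all_reals all_analysis.
From mathcomp Require Import lra.

(** Two facts about one step carry the whole result.  For a continuous map
    [f : X -> Y] of locally compact Hausdorff spaces, the map [unified_map]
    from the unified space to [Y] is proper: an ultrafilter over a compact set
    either contains the copy of a compact part of [X], and then converges there,
    or avoids all of them, and then converges to the point of [Y] below it.  And
    if preimages of compact subsets of [U] are compact, the copy of [U] in the
    unified space is open, so [runified f U] is closed in it and its map to [Y]
    is still proper.  Hence, by induction, the stages are Hausdorff, their
    bonding maps are continuous and proper, and [X i] sits in the [i]-th stage
    as an open subspace ([reg_stageP]).

    (a), (b): in an inverse limit of Hausdorff spaces along proper maps the
    projections are proper, by Tychonoff's theorem ([invlim_proj_proper]); local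
    compactness of the limit is then pulled back from [X 0].  When the bonding
    maps are moreover surjective, each point of a stage lies on a thread
    ([invlim_thread]), so the projections are surjective.

    (c) is checked on coordinates.

    (d): second countability passes from [X] and [Y] to the unified space because
    [X] has a countable cofinal family of compact sets, and then to the limit
    because its topology is generated by preimages from single stages.  A
    second countable locally compact Hausdorff space is metrised by
    the supremum of countably many weighted Urysohn functions
    ([locally_compact_metrisable]).

    (e): for [U i `<=` V i] there are continuous injections from the stages for
    [V] to the stages for [U] that respect the copies of [X i] and the bonding
    maps.  They induce an injective map [h] of the limits over [X 0], and [h] is
    proper because the projections to [X 0] are; an injective proper map into a
    locally compact Hausdorff space is a closed embedding, which gives the
    closedness and the homeomorphism at once.  The image of [h] is computed from
    the description of the points: a thread that does not stay in the [X i] leaves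
    them at some stage, and from there on it is constant ([reglim_case]). *)

Set Implicit Arguments.
Unset Strict Implicit.
Unset Printing Implicit Defensive.

Import Order.TTheory GRing.Theory Num.Theory.
Import numFieldNormedType.Exports.

Local Open Scope classical_set_scope.

(** * Inducing maps, proper maps and closed embeddings *)

(** Exactly the condition that [S] carries the initial topology of [p].  It covers
    both subspace inclusions and open embeddings, so that compactness and
    continuity are transferred through either by the same lemmas. *)
Definition inducing (S T : topologicalType) (p : S -> T) : Prop :=
  forall (x : S) (N : set S), nbhs x N ->
    exists2 M, nbhs (p x) M & p @^-1` M `<=` N.

Lemma set_val_inducing (T : topologicalType) (A : set T) :
  inducing (set_val : A -> T).
Proof.
move=> x N [_ [[G oG <-] Gx] GN]; exists G => //.
exact: open_nbhs_nbhs.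
Qed.

Lemma set_val_continuous (T : topologicalType) (A : set T) :
  continuous (set_val : A -> T).
Proof. exact: initial_continuous. Qed.

Lemma open_injective_inducing (S T : topologicalType) (p : S -> T) :
  injective p -> (forall V, open V -> open (p @` V)) -> inducing p.
Proof.
move=> pI pO x N; rewrite nbhsE => -[V [oV Vx] VN].
exists (p @` V); first by apply: open_nbhs_nbhs; split; [exact: pO|exists x].
by move=> y [z Vz /pI <-]; exact: VN.
Qed.

Lemma inducing_continuous (Q S T : topologicalType) (p : S -> T) (g : Q -> S) :
  inducing p -> continuous (p \o g) -> continuous g.
Proof.
move=> ip cpg z N /ip[M pM MN].
by apply: filterS MN _; exact: cpg.
Qed.

(** The hypothesis on the range cannot be dropped: it puts the cluster point found
    in [C] back into [S]. *)
Lemma inducing_compact (S T : topologicalType) (p : S -> T) (C : set T) :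
  inducing p -> compact C -> C `<=` range p -> compact (p @^-1` C).
Proof.
move=> ip cC Cp F PF FC.
have [|c [Cc clc]] := cC (p @ F) _; first exact: FC.
have [x _ px] := Cp _ Cc; subst c.
exists x; split => // A N FA /ip[M pM MN].
have [|_ [[a Aa <-] Ma]] := clc (p @` A) M _ pM.
  by apply: (@filterS _ F _ A) => // a Aa; exists a.
by exists a; split => //; exact: MN.
Qed.

Lemma hausdorff_injective (S T : topologicalType) (p : S -> T) :
  continuous p -> injective p -> hausdorff_space T -> hausdorff_space S.
Proof.
move=> cp pI hT x y cl; apply/pI/hT => A B nA nB.
by have [z [Az Bz]] := cl _ _ (cp _ _ nA) (cp _ _ nB); exists (p z).
Qed.

Lemma locally_compactP (T : topologicalType) :
  locally_compact [set: T] <->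
  forall x : T, exists K, [/\ nbhs x K, compact K & closed K].
Proof.
split=> [lc x|lc x _].
  by have [K] := lc x I; rewrite withinET => Kx [cK clK]; exists K.
by have [K [Kx cK clK]] := lc x; rewrite withinET; exists K.
Qed.

Lemma proper_locally_compact (S T : topologicalType) (f : S -> T) :
  continuous f -> proper_map f ->
  locally_compact [set: T] -> locally_compact [set: S].
Proof.
move=> cf pf /locally_compactP lT; apply/locally_compactP => x.
have [K [Kx cK clK]] := lT (f x).
exists (f @^-1` K); split; [exact: cf|exact: pf|].
by apply: closed_comp => // y _; exact: cf.
Qed.

Lemma compact_nbhs_sub (T : topologicalType) (x : T) (N : set T) :
  hausdorff_space T -> locally_compact [set: T] -> nbhs x N ->
  exists K, [/\ nbhs x K, compact K & K `<=` N].
Proof.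
move=> hT /locally_compactP/(_ x)[K [Kx cK clK]] Nx.
have [M Mx MN] := compact_regular hT cK Kx Nx.
exists (closure M `&` K); split.
- by apply: filterI => //; apply: filterS Mx; exact: subset_closure.
- by rewrite setIC; apply: compact_closedI => //; exact: closed_closure.
- by move=> y [/MN].
Qed.

(** Near a point [y] of the closure it is enough to look at the part of the image
    that lies in a compact neighbourhood [K] of [y]; properness makes that part the
    image of a compact set, hence closed. *)
Lemma proper_closed_map (S T : topologicalType) (h : S -> T) (A : set S) :
  hausdorff_space T -> locally_compact [set: T] ->
  continuous h -> proper_map h -> closed A -> closed (h @` A).
Proof.
move=> hT /locally_compactP lT ch ph clA y clhA.
have [K [Ky cK _]] := lT y.
have : closed (h @` (h @^-1` K `&` A)).
  apply: compact_closed => //; apply: continuous_compact.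
    by apply: continuous_subspaceT => z; exact: ch.
  by apply: compact_closedI => //; exact: ph.
suff cly : closure (h @` (h @^-1` K `&` A)) y.
  by move=> /(_ _ cly)[x [_ Ax] <-]; exists x.
move=> N Ny; have [_ [[x Ax <-] [Kx Nx]]] := clhA _ (filterI Ky Ny).
by exists (h x); split => //; exists x.
Qed.

(** Continuity of the inverse is read off on complements of open sets, whose
    images are closed by hypothesis. *)
Lemma closed_embedding_homeomorphism (S T : topologicalType) (B : set T)
    (h : S -> B) :
  continuous (set_val \o h) -> injective (set_val \o h) ->
  (forall A, closed A -> closed ((set_val \o h) @` A)) ->
  B `<=` range (set_val \o h) -> homeomorphism h.
Proof.
move=> ch hI hcl Bh.
have surj (b : B) : exists x, h x = b.
  by have [x _ hx] := Bh _ (set_valP b); exists x; exact: val_inj.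
have [g gh] := choice surj.
have hg : cancel h g by move=> x; apply: hI => /=; rewrite gh.
exists g; split=> //; first exact: inducing_continuous (@set_val_inducing _ B) ch.
apply/continuousP => V oV.
exists (~` ((set_val \o h) @` ~` V)).
  by apply: closed_openC; apply: hcl; exact: open_closedC.
apply/seteqP; split=> [b /= nb|b Vb [x nVx xb]].
  by apply: contrapT => nV; apply: nb; exists (g b) => //=; rewrite gh.
by apply: nVx; rewrite -(hg x); congr (V (g _)): Vb; exact: val_inj.
Qed.

(** * Countable bases and metrisation *)

(** A base as an indexed family: index types can be summed and multiplied when
    bases are combined, without countability proofs for sets of sets. *)
Definition enumerated_base (T : topologicalType) (I : Type) (b : I -> set T) :=
  (forall n, open (b n)) /\
  (forall x A, nbhs x A -> exists n, b n x /\ b n `<=` A).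

Lemma second_countableP (T : topologicalType) :
  @second_countable T <->
  exists (I : countType) (b : I -> set T), enumerated_base b.
Proof.
split=> [[B cB [oB nB]]|[I [b [ob nb]]]].
  have /countable_injP[f fI] := cB.
  pose b (n : nat) := xget set0 [set A | B A /\ f A = n].
  have bf A : B A -> b (f A) = A.
    move=> BA; rewrite /b; case: xgetP => [C _ [BC fCA]|/(_ A)[]//].
    by apply: fI; rewrite ?inE.
  exists nat, b; split=> [n|x A /nB[C [BC Cx] CA]].
    rewrite /b; case: xgetP => [C _ [BC _]|_]; [exact: oB|exact: open0].
  by exists (f C); rewrite bf.
exists (range b); first by apply: card_le_trans (card_image_le _ _) _; exact: countableP.
split=> [_ [n _ <-]//|x A /nb[n [bx bA]]].
by exists (b n) => //; split=> //; exists n.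
Qed.

Lemma second_countable_nat_base (T : topologicalType) :
  @second_countable T -> exists b : nat -> set T, enumerated_base b.
Proof.
move=> /second_countableP[I [b [ob nb]]].
exists (fun n => if unpickle n is Some i then b i else set0); split=> [n|x A].
  by case: unpickle => [i|]; [exact: ob|exact: open0].
by move=> /nb[i bi]; exists (pickle i); rewrite pickleK.
Qed.

Section Metrisation.
Local Open Scope ring_scope.
Variables (R : realType) (T : topologicalType).

(** The metric is [sup_n |phi n x - phi n y| / (n + 1)].  Separation makes small
    balls fit into neighbourhoods; balls are open because all but finitely many
    terms are small uniformly in [y], by the weights. *)
Lemma separating_sequence_metrisable (phi : nat -> T -> R) :
  hausdorff_space T ->
  (forall n, continuous (phi n)) -> (forall n x, 0 <= phi n x <= 1) ->
  (forall x A, nbhs x A -> exists n, exists2 e : R, 0 < e &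
     forall y, `|phi n x - phi n y| < e -> A y) ->
  metrisable R T.
Proof.
move=> hT cphi phi01 sep.
pose t x y n : R := n.+1%:R^-1 * `|phi n x - phi n y|.
have phi_le1 n x y : `|phi n x - phi n y| <= 1.
  have /andP[x0 x1] := phi01 n x; have /andP[y0 y1] := phi01 n y.
  by rewrite ler_norml; apply/andP; split; lra.
have w_gt0 n : 0 < n.+1%:R^-1 :> R by rewrite invr_gt0.
have t_le x y n : t x y n <= n.+1%:R^-1.
  by rewrite -[leRHS]mulr1 ler_pM2l.
have t_ub x y : has_ubound (range (t x y)).
  exists 1 => _ [n _ <-]; apply: (le_trans (t_le _ _ _)).
  by rewrite invf_le1 // ler1n.
pose d x y : R := sup (range (t x y)).
have d_ge x y n : t x y n <= d x y by apply: ub_le_sup => //; exists n.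
have d_le x y M : (forall n, t x y n <= M) -> d x y <= M.
  by move=> tM; apply: ge_sup => [|_ [n _ <-] //]; exists (t x y 0%N), 0%N.
have t_ge0 x y n : 0 <= t x y n by rewrite mulr_ge0 // ltW.
have d_ge0 x y : 0 <= d x y by apply: le_trans (d_ge x y 0%N).
have d_small x A : nbhs x A -> exists2 e, 0 < e & forall y, d x y < e -> A y.
  move=> /sep[n [e e0 eA]]; exists (n.+1%:R^-1 * e); first exact: mulr_gt0.
  move=> y dxy; apply: eA; rewrite -(ltr_pM2l (w_gt0 n)).
  exact: le_lt_trans (d_ge x y n) dxy.
exists d; split.
- split=> // x y; split=> [dxy|->]; last first.
    apply/le_anti/andP; split=> //; apply: d_le => n.
    by rewrite /t subrr normr0 mulr0.
  apply: hT => A B /d_small[e e0 eA] /nbhs_singleton By.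
  by exists y; split => //; apply: eA; rewrite dxy.
- move=> x y; rewrite /d; suff -> : t x y = t y x by [].
  by apply/funext => n; rewrite /t distrC.
- move=> x y z; apply: d_le => n.
  apply: (le_trans _ (lerD (d_ge x y n) (d_ge y z n))).
  by rewrite /t -mulrDr ler_pM2l // ler_distD.
- move=> A; split=> [oA x Ax|bA].
    have [e e0 eA] := d_small x A (open_nbhs_nbhs (conj oA Ax)).
    by exists e.
  rewrite openE => x /bA[e e0 eA]; apply: filterS eA _.
  have e2 : 0 < e / 2 by rewrite divr_gt0.
  (* Terms of index at least [N] are below [e / 2] by their weight alone. *)
  have [N] := @ltr_add_invr R 0 (e / 2) e2; rewrite add0r => Ne.
  have near_lt m : nbhs x [set y | forall n, (n < m)%N -> `|phi n x - phi n y| < e / 2].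
    elim: m => [|m IH]; first by apply: filterS filterT => y _ n.
    have /cvgr_dist_lt/(_ _ e2) := cphi m x.
    move=> /(filterI IH); apply: filterS => y [ym my] n.
    by rewrite ltnS leq_eqVlt => /predU1P[->//|]; exact: ym.
  apply: filterS (near_lt N) => y yN /=.
  apply: (@le_lt_trans _ _ (e / 2)); last by rewrite ltr_pdivrMr // mulr_natr mulr2n ltrDl.
  apply: d_le => n; have [nN|Nn] := ltnP n N.
    apply: (@le_trans _ _ `|phi n x - phi n y|); last exact/ltW/yN.
    by rewrite ler_piMl // invf_le1 // ler1n.
  apply: (le_trans (t_le _ _ _)); apply: le_trans (ltW Ne).
  by rewrite lef_pV2 ?posrE // ler_nat.
Qed.

(** Urysohn functions are chosen only for pairs of members of the base, to keep
    the family countable: a function separating a point [x] from the complement of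
    a base set is at most [1 / 3] on some smaller base set around [x], and any
    function chosen for this pair separates [x] equally well. *)
Lemma locally_compact_metrisable :
  hausdorff_space T -> locally_compact [set: T] -> @second_countable T ->
  metrisable R T.
Proof.
move=> hT lT /second_countableP[I [b [ob nb]]].
pose good (ij : I * I) (f : T -> R) := [/\ continuous f, forall x, 0 <= f x <= 1,
  forall x, b ij.1 x -> f x <= 1 / 3 & forall x, ~ b ij.2 x -> f x = 1].
pose phi n : T -> R :=
  if unpickle n is Some ij then xget (cst 0) [set f | good ij f] else cst 0.
have phiP n : phi n = cst 0 \/ exists ij, good ij (phi n).
  rewrite /phi; case: unpickle => [ij|]; last by left.
  by case: xgetP => [f _ gf|]; [right; exists ij|left].
apply: (@separating_sequence_metrisable phi) => // [n|n x|x A /nb[j [bx bA]]].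
- by case: (phiP n) => [->|[ij []//]]; exact: cst_continuous.
- by case: (phiP n) => [->|[ij []//]]; rewrite lexx ler01.
have := @locally_compact_completely_regular T R lT hT x (~` b j)
  (open_closedC (ob j)) (fun nb => nb bx).
move=> /(@uniform_separatorP T R)[f [cf f01 fx fb]].
have fx0 : f x = 0 by apply: fx; exists x.
have : nbhs x [set y | f y < 1 / 3].
  have lt13 : nbhs (f x) [set r | r < 1 / 3] by rewrite fx0; apply: lt_nbhsl; lra.
  exact: (cf x _ lt13).
move=> /nb[i [ix fi]].
have gf : good (i, j) f.
  split=> // [y|y /fi/ltW //|y bjy]; last by apply: fb; exists y.
  by have := f01 (f y) (imageT f y); rewrite /= in_itv.
have : good (i, j) (phi (pickle (i, j))).
  by rewrite /phi pickleK; case: xgetP => // /(_ f)/(_ gf).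
move=> [_ _ gi gj].
exists (pickle (i, j)), (2 / 3); first lra.
move=> y; apply: contraPP => nAy.
rewrite (gj y) /=; last by move=> /bA.
by have := gi x ix => gx; rewrite ltr_norml; lra.
Qed.
End Metrisation.

(** * Threads and inverse limits *)

Lemma dependent_choice_nat (T : nat -> Type) (D : forall i, set (T i))
    (R : forall i, T i -> T i.+1 -> Prop) (t0 : T 0) :
  D 0 t0 ->
  (forall i t, D i t -> exists2 w, R i t w & D i.+1 w) ->
  exists z : forall i, T i, [/\ z 0 = t0, forall i, D i (z i) &
    forall i, R i (z i) (z i.+1)].
Proof.
move=> Dt0 DR.
have next i (t : {t | D i t}) : {w | D i.+1 w & R i (sval t) w}.
  by apply: cid2; have [w ? ?] := DR _ _ (svalP t); exists w.
pose z i : {t | D i t} := nat_rect (fun i => {t | D i t}) (exist _ t0 Dt0)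
  (fun i t => exist _ (s2val (next i t)) (s2valP (next i t))) i.
exists (fun i => sval (z i)); split=> // i; first exact: svalP.
exact: s2valP' (next i (z i)).
Qed.

(** Upward the thread is built by dependent choice along [R], downward by applying
    [g].  The induction on [k] drops the first term of the sequence instead of
    going down from [k], which keeps the dependent types free of casts. *)
Lemma invlim_thread (T : nat -> Type) (g : forall i, T i.+1 -> T i)
    (D : forall i, set (T i)) (R : forall i, T i -> T i.+1 -> Prop) :
  (forall i t w, R i t w -> g i w = t) ->
  (forall i t, D i t -> exists2 w, R i t w & D i.+1 w) ->
  forall k (y : T k), D k y -> exists z : forall i, T i,
    [/\ forall i, g i (z i.+1) = z i, z k = y &
        forall i, (k <= i)%N -> R i (z i) (z i.+1)].
Proof.
move=> Rg DR k; elim: k T g D R Rg DR => [|k IH] T g D R Rg DR y Dy.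
  have [z [z0 _ Rz]] := dependent_choice_nat Dy DR.
  by exists z; split=> // i; exact: Rg.
have [z [gz zk Rz]] := IH (fun i => T i.+1) (fun i => g i.+1) (fun i => D i.+1)
  (fun i => R i.+1) (fun i => Rg i.+1) (fun i => DR i.+1) y Dy.
exists (fun i => if i is j.+1 then z j else g 0 (z 0)); split=> //.
- by case=> //= i; exact: gz.
- by case=> //= i; exact: Rz.
Qed.

Section InverseLimit.
Variables (Y : nat -> topologicalType) (g : forall i, Y i.+1 -> Y i).
Arguments g : clear implicits.
Hypothesis g_continuous : forall i, continuous (g i).

Lemma invlim_projE (k : nat) (x : invlim g) :
  g k (invlim_proj k.+1 x) = invlim_proj k x.
Proof. exact: (set_valP x k). Qed.

Lemma invlim_eq (x y : invlim g) :
  (forall k, invlim_proj k x = invlim_proj k y) -> x = y.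
Proof. by move=> xy; apply/val_inj/functional_extensionality_dep => k; exact: xy. Qed.

Lemma invlim_proj_continuous (k : nat) : continuous (@invlim_proj Y g k).
Proof.
move=> x; apply: (@continuous_comp _ _ _ set_val (fun z : prod_topology Y => z k)).
  exact: set_val_continuous.
exact: (@proj_continuous _ Y k).
Qed.

(** The sets on the right form a filter: preimages from stage [k] are preimages
    from any later stage, so two of them can be intersected at a common stage.
    This filter converges to [x] in the product because it does so on every
    coordinate. *)
Lemma invlim_nbhs (x : invlim g) (N : set (invlim g)) : nbhs x N ->
  exists k M, nbhs (invlim_proj k x) M /\ (@invlim_proj Y g k) @^-1` M `<=` N.
Proof.
pose G k := [set A | exists2 M, nbhs (invlim_proj k x) M &
                       (@invlim_proj Y g k) @^-1` M `<=` A].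
have GS k m A : (k <= m)%N -> G k A -> G m A.
  move=> /subnK <-; elim: (m - k)%N => // n IH /IH[M nM MA].
  exists (g (n + k)%N @^-1` M) => [|y /=].
    by apply: g_continuous; rewrite invlim_projE.
  by rewrite invlim_projE; exact: MA.
pose GG : set_system (invlim g) := [set A | exists k, G k A].
have GF : Filter GG.
  split=> [|A B [k GA] [m GB]|A B AB [k [M nM MA]]].
  - by exists 0, setT => //; exact: filterT.
  - have [M nM MA] := GS _ _ _ (leq_maxl k m) GA.
    have [L nL LB] := GS _ _ _ (leq_maxr k m) GB.
    exists (maxn k m), (M `&` L); first exact: filterI.
    by move=> y [/MA ? /LB].
  - by exists k, M => //; apply: subset_trans AB.
have Gx : (set_val : invlim g -> prod_topology Y) @ GG -->
    (set_val x : prod_topology Y).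
  apply/cvg_sup => k A [_ [[B oB <-] Bx] BA].
  exists k, B; first exact: open_nbhs_nbhs.
  by move=> y By; exact: BA.
move=> /(@set_val_inducing (prod_topology Y))[M /Gx[k [L nL LM]] MN].
by exists k, L; split => // y /LM; exact: MN.
Qed.

Lemma invlim_continuous (Q : topologicalType) (h : Q -> invlim g) :
  (forall k, continuous (fun z => invlim_proj k (h z))) -> continuous h.
Proof.
move=> ch z N /invlim_nbhs[k [M [nM MN]]].
by apply: (@filterS _ (nbhs z) _ _ _ _ (ch k z M nM)) => w; exact: MN.
Qed.

Hypothesis Y_hausdorff : forall i, hausdorff_space (Y i).

Lemma invlim_hausdorff : hausdorff_space (invlim g).
Proof.
move=> x y cl; apply: invlim_eq => k; apply: Y_hausdorff => A B nA nB.
have [z [Az Bz]] := cl _ _ (invlim_proj_continuous nA) (invlim_proj_continuous nB).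
by exists (invlim_proj k z).
Qed.

Lemma invlim_closed : closed (invlim g).
Proof.
move=> p clp i; apply: Y_hausdorff => A B nA nB.
have nA' : nbhs p (fun z : prod_topology Y => A (g i (z i.+1))).
  exact: (@proj_continuous _ Y i.+1 p _ (g_continuous nA)).
have nB' : nbhs p (fun z : prod_topology Y => B (z i)).
  exact: (@proj_continuous _ Y i p _ nB).
have [z [gz [Az Bz]]] := clp _ (filterI nA' nB').
by exists (z i); split => //; rewrite -(gz i).
Qed.

Hypothesis g_proper : forall i, proper_map (g i).

(** Compact boxes for Tychonoff's theorem: every thread that starts in [C] has its
    [k]-th coordinate in the [k]-th set. *)
Fixpoint pullback0 (C : set (Y 0)) (k : nat) : set (Y k) :=
  match k with 0 => C | k.+1 => g k @^-1` @pullback0 C k end.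

Fixpoint to0 (k : nat) : Y k -> Y 0 :=
  match k with 0 => id | k.+1 => fun y => to0 (g k y) end.

Lemma to0_continuous k : continuous (@to0 k).
Proof.
elim: k => [|k IH] x /=; first exact: cvg_id.
by apply: continuous_comp; [exact: g_continuous|exact: IH].
Qed.

Lemma to0E k (x : invlim g) : to0 (invlim_proj k x) = invlim_proj 0 x.
Proof. by elim: k => //= k <-; rewrite invlim_projE. Qed.

Lemma invlim_proj0_proper : proper_map (@invlim_proj Y g 0).
Proof.
move=> C cC.
have cD k : compact (@pullback0 C k).
  by elim: k => //= k IH; exact: g_proper.
have := compact_closedI (tychonoff cD) invlim_closed.
move/(inducing_compact (@set_val_inducing (prod_topology Y) (invlim g))).
rewrite [X in compact X](_ : _ = (@invlim_proj Y g 0) @^-1` C); last first.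
  apply/seteqP; split=> [x [/(_ 0)]//|x Cx].
  split; last exact: set_valP.
  by elim=> //= k; rewrite [g k _](invlim_projE k x).
apply; move=> z [_ gz].
by exists (SigSub (mem_set gz)).
Qed.

(** It suffices to treat stage [0]: the threads through [C] at stage [k] form a
    closed set of threads through the image of [C] in [Y 0]. *)
Lemma invlim_proj_proper (k : nat) : proper_map (@invlim_proj Y g k).
Proof.
move=> C cC.
apply: (subclosed_compact _ (invlim_proj0_proper (K := (@to0 k) @` C) _)).
- apply: closed_comp; last exact: compact_closed.
  by move=> x _; exact: invlim_proj_continuous.
- apply: continuous_compact => //.
  by apply: continuous_subspaceT => x; exact: to0_continuous.
- by move=> x Cx; exists (invlim_proj k x); rewrite ?to0E.
Qed.

End InverseLimit.


Lemma invlim_second_countable (Y : nat -> topologicalType)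
    (g : forall i, Y i.+1 -> Y i) :
  (forall i, continuous (g i)) -> (forall i, @second_countable (Y i)) ->
  @second_countable (invlim g).
Proof.
move=> cg sY.
pose b i := sval (cid (second_countable_nat_base (sY i))).
have bP i : enumerated_base (b i) := svalP (cid (second_countable_nat_base (sY i))).
apply/second_countableP; exists (nat * nat)%type,
  (fun kn => @invlim_proj Y g kn.1 @^-1` b kn.1 kn.2).
split=> [[k n]|x A /(invlim_nbhs cg)[k [M [/(proj2 (bP k))[n [bx bM]] MA]]]].
  apply: open_comp; last exact: (proj1 (bP k)).
  by move=> x _; exact: invlim_proj_continuous.
by exists (k, n); split=> // y /bM; exact: MA.
Qed.

(** * The unified space of one map *)

(** Finite unions of the relatively compact members of a countable base. *)
Lemma second_countable_exhaustion (T : topologicalType) :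
  locally_compact [set: T] -> @second_countable T ->
  exists K : nat -> set T,
    (forall n, compact (K n)) /\
    (forall C, compact C -> exists n, C `<=` K n).
Proof.
move=> /locally_compactP lT /second_countable_nat_base[b [ob nb]].
pose c n := if `[< compact (closure (b n)) >] then closure (b n) else set0.
have cc n : compact (c n).
  by rewrite /c; case: asboolP => // _; exact: compact0.
pose K n := \big[setU/set0]_(i < n) c i.
exists K; split=> [n|C cC]; first exact: bigsetU_compact.
have /compact_near_coveringP/(_ _ _ (fun n x => K n x) eventually_filter) := cC.
case=> [x _|N _ /(_ N (leqnn N)) CK]; last by exists N.
have [L [Lx cL clL]] := lT x; have [n [bx bL]] := nb _ _ Lx.
have cn : c n = closure (b n).
  rewrite /c; case: asboolP => // -[]; apply: (subclosed_compact _ cL).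
    exact: closed_closure.
  by move/closure_id: clL => ->; exact: closureS.
exists (b n, [set m | (n < m)%N]).
  split=> /=; first exact: open_nbhs_nbhs.
  by exists n.+1.
move=> [y m] /= [bny nm].
rewrite /K -(bigcup_mkord m c); exists n => //.
by rewrite cn; exact: subset_closure.
Qed.

Section Unified.
Variables (X Y : topologicalType) (f : X -> Y).
Hypotheses (hX : hausdorff_space X) (hY : hausdorff_space Y).
Hypothesis cf : continuous f.

Lemma unified_base_open (A : set (unified f)) : unified_base A -> open A.
Proof. by have [+ _] := unified_basis hX cf; exact. Qed.

Lemma unl_open (V : set X) : open V -> open (unl f @` V).
Proof. by move=> oV; apply: unified_base_open; left; exists V. Qed.

Lemma unified_open (V : set Y) (K : set X) : open V -> compact K ->
  open (@unified_map X Y f @^-1` V `&` ~` (unl f @` K)).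
Proof. by move=> oV cK; apply: unified_base_open; right; exists V, K. Qed.

Lemma nbhs_unl (x : X) (N : set (unified f)) :
  nbhs (unl f x) N <-> nbhs x (unl f @^-1` N).
Proof.
split=> [|].
  have [_ bN] := unified_basis hX cf.
  move=> /bN[B [[[V oV <-]|[V [K [oV cK ->]]]] +] BN].
    move=> [z Vz [zx]]; rewrite -zx; apply: filterS (open_nbhs_nbhs (conj oV Vz)) => w Vw /=.
    by apply: BN; exists w.
  move=> [Vx nKx]; have oK : open (~` K) by apply: closed_openC; exact: compact_closed.
  have nVK : nbhs x (f @^-1` V `&` ~` K).
    apply: filterI; first by apply: cf; exact: open_nbhs_nbhs.
    by apply: open_nbhs_nbhs; split=> // Kx; apply: nKx; exists x.
  apply: filterS nVK => w [Vw nKw] /=; apply: BN; split=> // -[u Ku [uw]].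
  by apply: nKw; rewrite -uw.
rewrite nbhsE => -[V [oV Vx] VN].
apply: (@filterS _ _ _ (unl f @` V)); first by move=> _ [w Vw <-]; exact: VN.
by apply: open_nbhs_nbhs; split; [exact: unl_open|exists x].
Qed.

Lemma nbhs_unr (y : Y) (N : set (unified f)) :
  nbhs (unr f y) N <-> exists V K, [/\ open V, V y, compact K &
    @unified_map X Y f @^-1` V `&` ~` (unl f @` K) `<=` N].
Proof.
split=> [|[V [K [oV Vy cK VKN]]]].
  have [_ bN] := unified_basis hX cf.
  move=> /bN[B [[[V oV <-]|[V [K [oV cK ->]]]] +] BN]; first by move=> [z].
  by move=> [Vy _]; exists V, K.
apply: filterS VKN _; apply: open_nbhs_nbhs; split; first exact: unified_open.
by split=> // -[].
Qed.

Lemma unl_continuous : continuous (unl f).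
Proof. by move=> x N /nbhs_unl. Qed.

Lemma unified_map_continuous : continuous (@unified_map X Y f).
Proof.
apply/continuousP => V oV; have := unified_open oV (@compact0 X).
by rewrite image_set0 setC0 setIT.
Qed.

(** The two cases are those of an ultrafilter that contains the copy of some
    compact subset of [X], and of one that runs to infinity in [X]; the latter
    converges to the point [unr f c] because basic neighbourhoods of that point omit
    only a compact part of [X]. *)
Lemma unified_map_proper : proper_map (@unified_map X Y f).
Proof.
move=> C cC; rewrite compact_ultra => F UF FC.
have [[K cK FK]|nFK] := pselect (exists2 K, compact K & F (unl f @` K)).
  have : compact (unl f @` K `&` @unified_map X Y f @^-1` C).
    apply: compact_closedI.
      apply: continuous_compact => //.
      by apply: continuous_subspaceT => x; exact: unl_continuous.
    apply: closed_comp; last exact: compact_closed.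
    by move=> x _; exact: unified_map_continuous.
  by rewrite compact_ultra => /(_ F UF (filterI FK FC))[p [[_ Cp] Fp]]; exists p.
have := cC; have PF : ProperFilter F by exact: ultra_proper.
move=> /(_ (@unified_map X Y f @ F) _ FC)[c [Cc clc]].
exists (unr f c); split=> // N /nbhs_unr[V [K [oV Vc cK VKN]]].
apply: filterS VKN _; apply: filterI.
  have [//|FnV] := in_ultra_setVsetC (@unified_map X Y f @^-1` V) UF.
  by have [z [/= nVz Vz]] := clc (~` V) V FnV (open_nbhs_nbhs (conj oV Vc)).
have [FK|//] := in_ultra_setVsetC (unl f @` K) UF.
by exfalso; apply: nFK; exists K.
Qed.

Hypothesis lX : locally_compact [set: X].

(** Points with different images are separated by preimages.  The remaining
    interesting case, [unl f x] against [unr f (f x)], is settled by a compact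
    neighbourhood of [x] and its complement. *)
Lemma unified_hausdorff : hausdorff_space (unified f).
Proof.
move=> p q cl.
have fpq : unified_map p = unified_map q.
  apply: hY => A B nA nB.
  have [z [Az Bz]] := cl _ _ (unified_map_continuous nA) (unified_map_continuous nB).
  by exists (unified_map z).
have nl x K : nbhs x K -> nbhs (unl f x) (unl f @` K).
  by move=> Kx; apply/nbhs_unl; apply: filterS Kx => w Kw; exists w.
have nr y K : compact K -> nbhs (unr f y) (~` (unl f @` K)).
  move=> cK; apply/nbhs_unr; exists setT, K.
  by split; [exact: openT| |exact: cK|move=> z []].
case: p q cl fpq => [x|y] [x'|y'] cl fpq.
- congr inl; apply: hX => A B /nl nA /nl nB.
  by have [_ [[a Aa <-] [b Bb [ba]]]] := cl _ _ nA nB; exists a; split=> //; rewrite -ba.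
- have /locally_compactP/(_ x)[K [/nl nK cK _]] := lX.
  by have [z []] := cl _ _ nK (nr y' K cK).
- have /locally_compactP/(_ x')[K [/nl nK cK _]] := lX.
  by have [z []] := cl _ _ (nr y K cK) nK.
- by congr inr.
Qed.

(** The compact sets removed in basic neighbourhoods of points of [Y] can be taken
    from a countable cofinal family. *)
Lemma unified_second_countable :
  @second_countable X -> @second_countable Y -> @second_countable (unified f).
Proof.
move=> sX sY.
have [K [cK Kcof]] := second_countable_exhaustion lX sX.
have /second_countableP[I [b [ob nb]]] := sX.
have /second_countableP[J [c [oc nc]]] := sY.
apply/second_countableP; exists (I + J * nat)%type, (fun s => match s with
  | inl i => unl f @` b i
  | inr jn => @unified_map X Y f @^-1` c jn.1 `&` ~` (unl f @` K jn.2) end).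
split=> [[i|[j n]]|[x|y] A]; [exact: unl_open|exact: unified_open| |].
  move=> /nbhs_unl/nb[i [bx bA]]; exists (inl i); split; first by exists x.
  by move=> _ [w bw <-]; exact: bA.
move=> /nbhs_unr[V [L [oV Vy cL VLA]]].
have [j [cy cV]] := nc _ _ (open_nbhs_nbhs (conj oV Vy)).
have [n Ln] := Kcof _ cL.
exists (inr (j, n)); split; first by split=> // -[].
move=> z [/= cz nKz]; apply: VLA; split; first exact: cV.
by move=> [w Lw wz]; apply: nKz; exists w => //; exact: Ln.
Qed.

Hypothesis lY : locally_compact [set: Y].
Variable U : set Y.
Hypothesis oU : open U.
Hypothesis pU : forall C, compact C -> C `<=` U -> compact (f @^-1` C).

(** For a compact neighbourhood [K] of [y] inside [U], removing the compact set
    [f @^-1` K] from the part above the interior of [K] leaves only points of [U]. *)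
Lemma runified_closed : closed (runified f U).
Proof.
rewrite -[runified f U]setCK; apply: open_closedC; rewrite openE => z nz.
have : exists2 y, U y & z = unr f y.
  case: z nz => [x|y] nz; first by exfalso; apply: nz; left; exists x.
  exists y => //; apply: contrapT => nUy.
  by apply: nz; right; exists y.
move=> [y Uy ->]; apply/nbhs_unr.
have [K [Ky cK KU]] := compact_nbhs_sub hY lY (open_nbhs_nbhs (conj oU Uy)).
exists K°, (f @^-1` K); split.
- exact: open_interior.
- exact: Ky.
- exact: pU.
move=> w [/interior_subset Kw nKw] [[x _ xw]|[u nUu uw]]; subst w.
  by apply: nKw; exists x.
by apply: nUu; exact: KU.
Qed.

Lemma runified_hausdorff : hausdorff_space (runified f U).
Proof.
apply: (@hausdorff_injective _ _ (set_val : runified f U -> unified f)).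
- exact: set_val_continuous.
- exact: val_inj.
- exact: unified_hausdorff.
Qed.

Lemma runified_map_continuous : continuous (runified_map f U).
Proof.
move=> z; apply: continuous_comp; first exact: set_val_continuous.
exact: unified_map_continuous.
Qed.

Lemma runified_map_proper : proper_map (runified_map f U).
Proof.
move=> C cC.
have := compact_closedI (unified_map_proper cC) runified_closed.
move/(inducing_compact (@set_val_inducing _ (runified f U))).
rewrite [X in compact X](_ : _ = runified_map f U @^-1` C); last first.
  apply/seteqP; split=> [x []//|x Cx].
  by split=> //; exact: set_valP.
by apply; move=> z [_ Az]; exists (SigSub (mem_set Az)).
Qed.

Lemma runified_locally_compact : locally_compact [set: runified f U].
Proof.
apply: proper_locally_compact lY; first exact: runified_map_continuous.
exact: runified_map_proper.
Qed.

Lemma runified_incl_continuous : continuous (runified_incl f U).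
Proof.
apply: (inducing_continuous (@set_val_inducing _ (runified f U))).
exact: unl_continuous.
Qed.

Lemma runified_incl_injective : injective (runified_incl f U).
Proof. by move=> x x' /(congr1 set_val)[]. Qed.

Lemma runified_incl_open (V : set X) : open V -> open (runified_incl f U @` V).
Proof.
move=> oV; exists (unl f @` V); first exact: unl_open.
apply/seteqP; split=> [z [x Vx xz]|_ [x Vx <-]]; last by exists x.
by exists x => //; exact: val_inj.
Qed.

Lemma runified_second_countable :
  @second_countable X -> @second_countable Y -> @second_countable (runified f U).
Proof.
move=> sX sY; have /second_countableP[I [b [ob nb]]] := unified_second_countable sX sY.
apply/second_countableP; exists I, (fun i => (set_val : runified f U -> _) @^-1` b i).
split=> [i|z A /set_val_inducing[M /nb[i [bi bM]] MA]]; first by exists (b i).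
by exists i; split=> // w /bM; exact: MA.
Qed.

End Unified.

(** The form in which [f]-properness is used: it mentions no subtypes and is
    stable under composing [f] with an open embedding. *)
Lemma f_proper_compact (X Y : topologicalType) (f : X -> Y) (U C : set Y) :
  f_proper f U -> compact C -> C `<=` U -> compact (f @^-1` C).
Proof.
move=> [oU pU] cC CU.
have cCU : compact ((set_val : U -> Y) @^-1` C).
  apply: inducing_compact => //; first exact: set_val_inducing.
  by move=> y Cy; exists (SigSub (mem_set (CU y Cy))).
have := continuous_compact (continuous_subspaceT
  (@set_val_continuous _ (f @^-1` U))) (pU _ cCU).
congr compact; apply/seteqP; split=> [_ [z Cz <-] //|x Cx].
by exists (SigSub (mem_set (CU (f x) Cx : (f @^-1` U) x))).
Qed.

(** * Points of the regulated limit *)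

Section Points.
Variables (X : nat -> topologicalType) (f : forall i, X i.+1 -> X i).
Variable U : forall i, set (X i).
Arguments f : clear implicits.
Arguments U : clear implicits.

Lemma reg_map_incl i (x : X i.+1) :
  reg_map f U i (reg_incl f U i.+1 x) = reg_incl f U i (f i x).
Proof. by []. Qed.

Lemma reg_incl_injective i : injective (reg_incl f U i).
Proof. by case: i => [x x' //|i]; exact: runified_incl_injective. Qed.

Lemma reg_copy_map i (y : reg_space f U i) (w : reg_space f U i.+1) :
  reg_copy y w -> reg_map f U i w = y.
Proof. by rewrite /reg_copy /reg_map /runified_map => ->. Qed.

Lemma reg_copy_unique i (y : reg_space f U i) (w w' : reg_space f U i.+1) :
  reg_copy y w -> reg_copy y w' -> w = w'.
Proof. by move=> yw yw'; apply: val_inj; exact: etrans yw (esym yw'). Qed.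

Lemma reg_copy_exists i (y : reg_space f U i) :
  ~ (reg_incl f U i @` U i) y -> exists w : reg_space f U i.+1, reg_copy y w.
Proof.
move=> nUy.
have ry : runified (reg_incl f U i \o f i) (reg_incl f U i @` U i) (unr _ y).
  by right; exists y.
by exists (SigSub (mem_set ry)).
Qed.

Lemma reg_copy_notin_range i (y : reg_space f U i) (w : reg_space f U i.+1) :
  reg_copy y w -> ~ range (reg_incl f U i.+1) w.
Proof. by move=> yw [x _ xw]; move: yw; rewrite -xw. Qed.

Lemma reg_spaceS_case i (w : reg_space f U i.+1) :
  (exists x, w = reg_incl f U i.+1 x) \/
  (exists2 y, ~ (reg_incl f U i @` U i) y & reg_copy y w).
Proof.
have [[x _ xw]|[y nUy yw]] := set_valP (w : runified _ _).
  by left; exists x; apply: val_inj; exact: esym xw.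
by right; exists y.
Qed.

(** Once a thread is in [X i] at stage [i], all its earlier coordinates are
    determined: the bonding maps restrict to the [f k]. *)
Lemma reglim_low i (x : X i) (z : reglim f U) :
  reglim_proj f U i z = reg_incl f U i x ->
  forall (n k : nat) (e : i = (n + k)%N),
    reglim_proj f U k z = reg_incl f U k (bond f (ecast j (X j) e x)).
Proof.
have low n k (x' : X (n + k)%N) :
    reglim_proj f U (n + k) z = reg_incl f U (n + k) x' ->
    reglim_proj f U k z = reg_incl f U k (bond f x').
  elim: n x' => //= n IH x' zx; apply: IH.
  by rewrite -reg_map_incl -zx; exact/esym/invlim_projE.
move=> zx n k e; rewrite -(esymK e); move: (esym e) => e'.
by case: i / e' x zx {e} => x zx; exact: low.
Qed.

Lemma stage_point_unique i (x : X i) (z z' : reglim f U) :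
  stage_point x z -> stage_point x z' -> z = z'.
Proof.
move=> [lz cz] [lz' cz']; apply: invlim_eq => k.
have [ki|/ltnW] := leqP k i.
  have e : i = ((i - k) + k)%N by rewrite subnK.
  by rewrite [LHS](lz _ _ e) [RHS](lz' _ _ e).
move=> /subnK <-; elim: (k - i)%N => [|n IH].
  have e : i = (0 + i)%N by [].
  by rewrite [LHS](lz _ _ e) [RHS](lz' _ _ e).
apply: reg_copy_unique (cz _ (leq_addl n i)) _.
by have := cz' _ (leq_addl n i); rewrite /reglim_proj -IH.
Qed.

(** The thread runs outside [reg_incl f U k @` U k]; this condition allows each
    coordinate to be copied to the next stage, and a copy satisfies it again as it
    is outside the whole of [X k.+1]. *)
Lemma stage_point_exists i (x : X i) : ~ U i x ->
  exists z : reglim f U, stage_point x z.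
Proof.
move=> nUx.
pose D k : set (reg_space f U k) := ~` (reg_incl f U k @` U k).
have DR k t : D k t -> exists2 w, reg_copy t w & D k.+1 w.
  move=> /reg_copy_exists[w tw]; exists w => // -[x' _ xw].
  by apply: (reg_copy_notin_range tw); exists x'.
have Dx : D i (reg_incl f U i x) by move=> [x' Ux' /reg_incl_injective xx']; apply: nUx; rewrite -xx'.
have [z [gz zi cz]] := invlim_thread (g := reg_map f U)
  (fun k t w => @reg_copy_map k t w) DR Dx.
exists (SigSub (mem_set (gz : reglim f U z))); split; last exact: cz.
exact: reglim_low.
Qed.

(** Stage [0] is [X 0] itself, so a thread outside the inverse limit has a last
    coordinate [i] up to which it stays in the [X k].  It cannot return afterwards,
    since the bonding maps send [X k.+1] into [X k]; so every later coordinate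
    is the copy of the previous one. *)
Lemma reglim_case (z : reglim f U) : range (lim_incl f U) z \/
  exists i, exists2 x : X i, ~ U i x & stage_point x z.
Proof.
have gz k : reg_map f U k (reglim_proj f U k.+1 z) = reglim_proj f U k z.
  exact: invlim_projE.
have [allin|] := pselect (forall k, exists x, reglim_proj f U k z = reg_incl f U k x).
  left; pose x k := sval (cid (allin k)).
  have xz k : reglim_proj f U k z = reg_incl f U k (x k) := svalP (cid (allin k)).
  have fx : invlim f x.
    by move=> k; apply: (@reg_incl_injective k); rewrite -reg_map_incl -!xz gz.
  exists (SigSub (mem_set fx)) => //; apply: invlim_eq => k.
  by rewrite [RHS]xz.
move=> /existsNP[k nink]; right.
have [i [x zx nin]] : exists i, exists2 x,
    reglim_proj f U i z = reg_incl f U i x &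
    ~ range (reg_incl f U i.+1) (reglim_proj f U i.+1 z).
  elim: k nink => [[]|k IH nin]; first by exists (reglim_proj f U 0 z).
  have [[x zx]|/IH//] := pselect (exists x, reglim_proj f U k z = reg_incl f U k x).
  exists k, x => // -[x' _ x'z]; apply: nin; by exists x'.
have nin' m : (i <= m)%N -> ~ range (reg_incl f U m.+1) (reglim_proj f U m.+1 z).
  move=> /subnK <-; elim: (m - i)%N => // n IH [x' _ x'z]; apply: IH.
  by exists (f _ x') => //; rewrite -reg_map_incl x'z gz.
have copy m : (i <= m)%N -> reg_copy (reglim_proj f U m z) (reglim_proj f U m.+1 z)
    /\ ~ (reg_incl f U m @` U m) (reglim_proj f U m z).
  move=> im; have [[x' zx']|[y nUy yz]] := reg_spaceS_case (reglim_proj f U m.+1 z).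
    by case: (nin' _ im); exists x'.
  by rewrite -gz (reg_copy_map yz).
exists i, x.
  by move=> Ux; have [_] := copy i (leqnn i); apply; exists x.
by split=> [|m /copy[]//]; exact: reglim_low.
Qed.

End Points.

(** * The stages of the regulated limit *)

Section Stages.
Variables (X : nat -> topologicalType) (f : forall i, X i.+1 -> X i).
Variable U : forall i, set (X i).
Arguments f : clear implicits.
Arguments U : clear implicits.
Hypothesis hX : forall i, hausdorff_space (X i).
Hypothesis lX : forall i, locally_compact [set: X i].
Hypothesis cf : forall i, continuous (f i).
Hypothesis regU : regulating f U.

Lemma reg_incl_proper i (C : set (reg_space f U i)) :
  (forall V, open V -> open (reg_incl f U i @` V)) ->
  compact C -> C `<=` reg_incl f U i @` U i ->
  compact ((reg_incl f U i \o f i) @^-1` C).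
Proof.
move=> iO cC CU; rewrite comp_preimage.
apply: (f_proper_compact (regU i)).
  apply: inducing_compact => //.
    by apply: open_injective_inducing => //; exact: reg_incl_injective.
  by move=> y /CU[x _ <-]; exists x.
by move=> x /CU[x' Ux' /reg_incl_injective <-].
Qed.

Lemma reg_stageP i : [/\ hausdorff_space (reg_space f U i),
  locally_compact [set: reg_space f U i], continuous (reg_incl f U i) &
  forall V, open V -> open (reg_incl f U i @` V)].
Proof.
elim: i => [|i [hY lY ci iO]].
  split; [exact: hX|exact: lX|by move=> x; exact: cvg_id|].
  by move=> V oV; rewrite image_id.
have cif : continuous (reg_incl f U i \o f i).
  by move=> x; apply: continuous_comp; [exact: cf|exact: ci].
have oU : open (reg_incl f U i @` U i) by apply: iO; have [] := regU i.
have pU C := @reg_incl_proper i C iO.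
split.
- exact: runified_hausdorff.
- exact: runified_locally_compact.
- exact: runified_incl_continuous.
- by move=> V; exact: runified_incl_open.
Qed.

Lemma reg_space_hausdorff i : hausdorff_space (reg_space f U i).
Proof. by have [] := reg_stageP i. Qed.

Lemma reg_incl_continuous i : continuous (reg_incl f U i).
Proof. by have [] := reg_stageP i. Qed.

Lemma reg_incl_f_continuous i : continuous (reg_incl f U i \o f i).
Proof.
by move=> x; apply: continuous_comp; [exact: cf|exact: reg_incl_continuous].
Qed.

Lemma reg_map_continuous i : continuous (reg_map f U i).
Proof. by apply: runified_map_continuous => //; exact: reg_incl_f_continuous. Qed.

Lemma reg_map_proper i : proper_map (reg_map f U i).
Proof.
have [hY lY ci iO] := reg_stageP i.
apply: runified_map_proper => //.
- exact: reg_incl_f_continuous.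
- by apply: iO; have [] := regU i.
- by move=> C; exact: reg_incl_proper.
Qed.

Lemma reglim_proj_continuous k : continuous (reglim_proj f U k).
Proof. exact: invlim_proj_continuous. Qed.

Lemma reglim_proj_proper k : proper_map (reglim_proj f U k).
Proof.
apply: invlim_proj_proper; [exact: reg_map_continuous|exact: reg_space_hausdorff|].
exact: reg_map_proper.
Qed.

Lemma reglim_hausdorff : hausdorff_space (reglim f U).
Proof. exact/invlim_hausdorff/reg_space_hausdorff. Qed.

Lemma reglim_locally_compact : locally_compact [set: reglim f U].
Proof.
have [_ l0 _ _] := reg_stageP 0.
apply: (proper_locally_compact (@reglim_proj_continuous 0) _ l0).
exact: reglim_proj_proper.
Qed.

(** A point of [U i] is hit by [f i], any other point by its own copy. *)
Lemma reg_map_surjective i (y : reg_space f U i) :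
  f_perfect (f i) (U i) -> exists w, reg_map f U i w = y.
Proof.
move=> [_ [_ _ fU]].
have [[u Uu <-]|/reg_copy_exists[w yw]] := pselect ((reg_incl f U i @` U i) y).
  have : range (@restr_preimage _ _ (f i) (U i)) (SigSub (mem_set Uu)) by rewrite fU.
  move=> [x _ xu]; exists (reg_incl f U i.+1 (set_val x)).
  by rewrite reg_map_incl; congr (reg_incl f U i _); exact: (congr1 set_val xu).
by exists w; exact: reg_copy_map.
Qed.

Lemma reglim_proj_perfect k :
  perfect_regulating f U -> perfect_map (reglim_proj f U k).
Proof.
move=> perfU; split; [exact: reglim_proj_continuous|exact: reglim_proj_proper|].
apply/seteqP; split=> // y _.
have [|z [gz zk _]] := invlim_thread (g := reg_map f U) (D := fun=> setT)
  (R := fun i t w => reg_map f U i w = t) (fun i t w => id) _ (I : setT y).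
  by move=> i t _; have [w wt] := reg_map_surjective t (perfU i); exists w.
by exists (SigSub (mem_set (gz : reglim f U z))).
Qed.

Lemma lim_incl_continuous : continuous (lim_incl f U).
Proof.
apply: invlim_continuous => [|k]; first exact: reg_map_continuous.
move=> x; apply: (@continuous_comp _ _ _ (@invlim_proj _ f k) (reg_incl f U k)).
  exact: invlim_proj_continuous.
exact: reg_incl_continuous.
Qed.

Lemma lim_incl_injective : injective (lim_incl f U).
Proof.
move=> x y xy; apply: invlim_eq => k; apply: (@reg_incl_injective _ f U k).
exact: (congr1 (reglim_proj f U k) xy).
Qed.

Lemma reg_space_second_countable i :
  (forall i, @second_countable (X i)) -> @second_countable (reg_space f U i).
Proof.
move=> sX; elim: i => [|i IH]; first exact: sX.
apply: runified_second_countable => //.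
exact: reg_incl_f_continuous.
Qed.

End Stages.

(** * Comparison of two regulating sequences *)

Section Comparison.
Variables (X : nat -> topologicalType) (f : forall i, X i.+1 -> X i).
Variables U V : forall i, set (X i).
Arguments f : clear implicits.
Arguments U : clear implicits.
Arguments V : clear implicits.
Hypothesis hX : forall i, hausdorff_space (X i).
Hypothesis lX : forall i, locally_compact [set: X i].
Hypothesis cf : forall i, continuous (f i).
Hypotheses (regU : regulating f U) (regV : regulating f V).
Hypothesis UV : forall i, U i `<=` V i.

Definition comparison i (j : reg_space f V i -> reg_space f U i) : Prop :=
  [/\ continuous j, injective j & forall x, j (reg_incl f V i x) = reg_incl f U i x].

Definition comparison_lift i (j : reg_space f V i -> reg_space f U i)
    (j' : reg_space f V i.+1 -> reg_space f U i.+1) : Prop :=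
  (forall w, reg_map f U i (j' w) = j (reg_map f V i w)) /\
  (forall y w, reg_copy y w -> reg_copy (j y) (j' w)).

(** The map [j'] is the identity on [X i.+1] and [j] on copies; a copy exists on
    the side of [U] because [j y] in [U i] would force [y] in [U i], hence in [V i].
    For continuity at a copy, the basic neighbourhood given by [G] and a
    compact [K] in [X i.+1] is pulled back to the one given by [j @^-1` G] and the
    same [K]. *)
Lemma comparison_step i j : @comparison i j ->
  exists2 j', comparison_lift j j' & @comparison i.+1 j'.
Proof.
move=> [cj jI ji].
have ex (w : reg_space f V i.+1) : exists w' : reg_space f U i.+1,
    (forall x, w = reg_incl f V i.+1 x -> w' = reg_incl f U i.+1 x) /\
    (forall y, reg_copy y w -> reg_copy (j y) w').
  have [[x ->]|[y nVy yw]] := reg_spaceS_case w.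
    exists (reg_incl f U i.+1 x); split=> [x' /reg_incl_injective ->//|y].
    by move=> /reg_copy_notin_range; case; exists x.
  have [|w' jyw'] := @reg_copy_exists _ f U i (j y).
    move=> [u Uu]; rewrite -ji => /jI uy; apply: nVy.
    by exists u => //; exact: UV.
  exists w'; split=> [x xw|y' y'w].
    by case: (reg_copy_notin_range yw); rewrite xw; exists x.
  by rewrite -(reg_copy_map y'w) (reg_copy_map yw).
have [j' j'P] := choice ex.
have j'i x : j' (reg_incl f V i.+1 x) = reg_incl f U i.+1 x by apply: (j'P _).1.
have j'c y w : reg_copy y w -> reg_copy (j y) (j' w) by apply: (j'P _).2.
pose valU (w : runified (reg_incl f U i \o f i) (reg_incl f U i @` U i)) := set_val w.
pose valV (w : runified (reg_incl f V i \o f i) (reg_incl f V i @` V i)) := set_val w.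
have valU_copy y w : reg_copy y w -> valU (j' w) = unr _ (j y) by apply: j'c.
have valV_copy y w : reg_copy y w -> valV w = unr _ y by [].
have cU := reg_incl_f_continuous hX lX cf regU (i := i).
have cV := reg_incl_f_continuous hX lX cf regV (i := i).
exists j'.
  split=> // w; have [[x ->]|[y _ yw]] := reg_spaceS_case w.
    by rewrite j'i !reg_map_incl ji.
  by rewrite (reg_copy_map yw) (reg_copy_map (j'c _ _ yw)).
split=> // [|w1 w2 w12].
  apply: (inducing_continuous (p := valU)); first exact: set_val_inducing.
  have cvalV : continuous valV by exact: set_val_continuous.
  move=> w N Nw.
  have [[x wx]|[y _ yw]] := reg_spaceS_case w.
    have /(nbhs_unl (@hX i.+1) cU) Nx : nbhs (unl (reg_incl f U i \o f i) x) N.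
      by move: Nw; rewrite /= wx j'i.
    have : nbhs (unl (reg_incl f V i \o f i) x)
        (unl (reg_incl f V i \o f i) @` (unl (reg_incl f U i \o f i) @^-1` N)).
      apply/(nbhs_unl (@hX i.+1) cV); apply: filterS Nx => x' Nx'.
      by exists x'.
    rewrite wx => /(cvalV (reg_incl f V i.+1 x)) NV.
    apply: (@filterS _ (nbhs (reg_incl f V i.+1 x)) _ _ _ _ NV) => w' [x' Nx' xw'].
    have -> : w' = reg_incl f V i.+1 x' by apply: val_inj; exact: esym xw'.
    by rewrite /= j'i.
  have : nbhs (unr (reg_incl f U i \o f i) (j y)) N.
    by move: Nw; rewrite /= (valU_copy _ _ yw).
  move=> /(nbhs_unr (@hX i.+1) cU)[G [K [oG Gy cK GKN]]].
  have : nbhs (unr (reg_incl f V i \o f i) y)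
      (@unified_map _ _ (reg_incl f V i \o f i) @^-1` (j @^-1` G) `&`
       ~` (unl (reg_incl f V i \o f i) @` K)).
    apply/(nbhs_unr (@hX i.+1) cV); exists (j @^-1` G), K; split=> //.
    by apply: open_comp => // z _; exact: cj.
  rewrite -(valV_copy _ _ yw) => /(cvalV w) NV.
  apply: (@filterS _ (nbhs w) _ _ _ _ NV) => w' [Gw' nKw']; apply: GKN.
  have [[x wx]|[y' _ yw']] := reg_spaceS_case w'.
    move: Gw' nKw'; rewrite wx /= j'i => Gx nKx; split.
      by move: Gx; rewrite /= ji.
    by move=> [x' Kx' [xx']]; apply: nKx; exists x' => //; rewrite xx'.
  move: Gw'; rewrite /= (valU_copy _ _ yw') (valV_copy _ _ yw') => Gy'; split=> //.
  by move=> [].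
have [[x1 x1w]|[y1 _ y1w]] := reg_spaceS_case w1;
  have [[x2 x2w]|[y2 _ y2w]] := reg_spaceS_case w2.
- by move: w12; rewrite x1w x2w !j'i => /reg_incl_injective ->.
- case: (reg_copy_notin_range (j'c _ _ y2w)).
  by exists x1 => //; rewrite -w12 x1w j'i.
- case: (reg_copy_notin_range (j'c _ _ y1w)).
  by exists x2 => //; rewrite w12 x2w j'i.
- have := reg_copy_map (j'c _ _ y1w).
  rewrite w12 (reg_copy_map (j'c _ _ y2w)) => /jI y21; subst y2.
  exact: reg_copy_unique y1w y2w.
Qed.

(** Properness comes for free from the projections to [X 0], over which [h] is the
    identity: [h @^-1` C] is a closed subset of the compact set of threads starting
    in the projection of [C]. *)
Lemma reglim_comparison : exists h : reglim f V -> reglim f U,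
  [/\ continuous h, injective h, proper_map h,
      forall x, h (lim_incl f V x) = lim_incl f U x &
      forall i (x : X i) z, stage_point x z -> stage_point x (h z)].
Proof.
have [|j [j0 jP jS]] := @dependent_choice_nat
  (fun i => reg_space f V i -> reg_space f U i) comparison comparison_lift id _ comparison_step.
  by split=> // x; exact: cvg_id.
have thr (z : reglim f V) : reglim f U (fun k => j k (reglim_proj f V k z)).
  move=> k; have [jm _] := jS k; rewrite jm; congr (j k _).
  exact: (invlim_projE k z).
pose h z : reglim f U := SigSub (mem_set (thr z)).
have hE k z : reglim_proj f U k (h z) = j k (reglim_proj f V k z) by [].
have cm := reg_map_continuous hX lX cf regU.
have ch : continuous h.
  apply: invlim_continuous => // k z.
  apply: (@continuous_comp _ _ _ (reglim_proj f V k) (j k)).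
    exact: reglim_proj_continuous.
  by have [cj _ _] := jP k; exact: cj.
exists h; split=> //.
- move=> z z' zz'; apply: invlim_eq => k.
  by have [_ jI _] := jP k; apply: jI; rewrite -!hE zz'.
- move=> C cC.
  apply: (subclosed_compact _
    (reglim_proj_proper hX lX cf regV (K := reglim_proj f U 0 @` C) _)).
  + apply: closed_comp => [z _|]; first exact: ch.
    by apply: compact_closed => //; exact: reglim_hausdorff.
  + apply: continuous_compact => //; apply: continuous_subspaceT => z.
    exact: (@reglim_proj_continuous X f U 0 z).
  + by move=> z Cz; exists (h z) => //; rewrite hE j0.
- move=> x; apply: invlim_eq => k; have [_ _ ji] := jP k.
  exact: ji.
- move=> i x z [lz cz]; split=> [n k e|k ik].
    by rewrite hE (lz _ _ e); have [_ _ ji] := jP k; rewrite ji.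
  by have [_ jc] := jS k; rewrite !hE; apply: jc; exact: cz.
Qed.

Lemma reglim_identified : identified_with_closed_subset f U V.
Proof.
have [h [ch hI ph hl hs]] := reglim_comparison.
have hcl A : closed A -> closed (h @` A).
  move=> clA; apply: proper_closed_map => //.
    exact: reglim_hausdorff.
  exact: reglim_locally_compact.
have hsub : range h = sub_reglim f U V.
  apply/seteqP; split=> [_ [z _ <-]|z].
    have [[x _ <-]|[i [x nVx xz]]] := reglim_case z.
      by left; exists x.
    by right; exists i => //; exists x => //; exact: hs.
  move=> [[x _ <-]|[i _ [x nVx xz]]]; first by exists (lim_incl f V x).
  have [z' xz'] := stage_point_exists f nVx.
  by exists z' => //; exact: stage_point_unique (hs _ _ _ xz') xz.
have hin z : sub_reglim f U V (h z) by rewrite -hsub; exists z.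
pose h' z : sub_reglim f U V := SigSub (mem_set (hin z)).
split; first by rewrite -hsub; apply: hcl; exact: closedT.
exists h'; split=> [|x|i x z _ xz].
- apply: closed_embedding_homeomorphism => //.
  by rewrite -[X in X `<=` _]hsub.
- exact: hl.
- exact: hs.
Qed.

End Comparison.

Theorem corollary2p40 (R : realType) (X : nat -> topologicalType)
    (f : forall i : nat, X i.+1 -> X i) (U : forall i : nat, set (X i))
    (X_hausdorff : forall i : nat, hausdorff_space (X i))
    (X_locally_compact : forall i : nat, locally_compact [set: X i])
    (f_continuous : forall i : nat, continuous (f i))
    (U_regulating : regulating f U) :
  (* (a) *)
  (locally_compact [set: reglim f U] /\ hausdorff_space (reglim f U)) /\
  (* (b) *)
  ((forall k : nat, proper_map (reglim_proj f U k)) /\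
   (perfect_regulating f U ->
      forall k : nat, perfect_map (reglim_proj f U k))) /\
  (* (c) *)
  (continuous (lim_incl f U) /\ injective (lim_incl f U)) /\
  (* (d) *)
  ((forall i : nat, @second_countable (X i)) ->
     metrisable R (reglim f U)) /\
  (* (e) *)
  ((forall V : forall i : nat, set (X i),
      regulating f V -> (forall i : nat, U i `<=` V i) ->
      identified_with_closed_subset f U V) /\
   (* the unified limit is the regulated limit for empty sets *)
   identified_with_closed_subset f (fun=> set0) U).
Proof.
have hT := reglim_hausdorff X_hausdorff X_locally_compact f_continuous U_regulating.
have lT := reglim_locally_compact X_hausdorff X_locally_compact f_continuous U_regulating.
split; first by split.
split; first split.
- exact: reglim_proj_proper.
- by move=> perfU k; exact: reglim_proj_perfect.
split; first split.
- exact: lim_incl_continuous.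
- exact: lim_incl_injective.
split.
  move=> sX; apply: locally_compact_metrisable => //.
  apply: invlim_second_countable => i.
    exact: reg_map_continuous.
  exact: reg_space_second_countable.
split=> [V regV UV|]; first exact: reglim_identified.
apply: reglim_identified => // i; last exact: sub0set.
split; first exact: open0.
move=> K _; rewrite [X in compact X](_ : _ = set0); first exact: compact0.
by apply/seteqP; split=> // x; case: (set_valP x).
Qed.
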